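(* Let $m\ge 2$, $n\ge 1$, let $\mathcal{A}=(a_{i_1\cdots i_m})\in T_{m,n}$ be strictly semi-positive, let $q\in\mathbb{R}^n$, and let $x$ be a solution of TCP$(\mathcal{A},q)$. If $m$ is even, then $$\frac{\|(-q)_+\|_\infty}{\max\limits_{i\in I_n}\left(\sum\limits_{i_2,\dots,i_m=1}^{n}|a_{ii_2\cdots i_m}|\right)}\le\|x\|_\infty^{m-1}\le\frac{\|(-q)_+\|_\infty}{\beta(\mathcal{A})}.$$
   Context: $T_{m,n}$ is the set of real tensors $\mathcal{A}=(a_{i_1\cdots i_m})$ of order $m$ and dimension $n$, with indices in $I_n=\{1,\dots,n\}$ and no symmetry assumed. For $x\in\mathbb{R}^n$, $\mathcal{A}x^{m-1}\in\mathbb{R}^n$ has components $(\mathcal{A}x^{m-1})_i=\sum_{i_2,\dots,i_m=1}^n a_{ii_2\cdots i_m}x_{i_2}\cdots x_{i_m}$. Inequalities between vectors are componentwise. $\mathcal{A}$ is strictly semi-positive if for each $x\ge 0$, $x\ne 0$, there is $k\in I_n$ with $x_k>0$ and $(\mathcal{A}x^{m-1})_k>0$. A solution of the tensor complementarity problem TCP$(\mathcal{A},q)$ is a vector $x\in\mathbb{R}^n$ with $x\ge 0$, $q+\mathcal{A}x^{m-1}\ge 0$ and $x^\top(q+\mathcal{A}x^{m-1})=0$. $x_+=(\max\{x_1,0\},\dots,\max\{x_n,0\})^\top$ and $\|x\|_\infty=\max_i|x_i|$. $\beta(\mathcal{A}):=\min_{x\ge 0,\ \|x\|_\infty=1}\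 \max_{i\in I_n}x_i(\mathcal{A}x^{m-1})_i$. *)

(* Defs.v *)
From HB Require Import structures.
From mathcomp Require Import all_boot all_order all_algebra.
From mathcomp Require Import all_classical all_reals all_analysis.

Set Implicit Arguments.
Unset Strict Implicit.
Unset Printing Implicit Defensive.

Import Order.TTheory GRing.Theory Num.Theory.
Import numFieldNormedType.Exports.

Local Open Scope classical_set_scope.
Local Open Scope ring_scope.

Section TensorComplementarity.
Context {R : realType}.

(* The entry a_{i_1 ... i_m} is [A [tuple i_1; ...; i_m]]. *)
Definition tensor (m n : nat) : Type := {ffun m.-tuple 'I_n -> R}.

(* For m > 0 the tuples with [ohead t = Some i] are the (i, i_2, ..., i_m),
   and [behead t] is then the list i_2, ..., i_m. *)
Definition tensor_app (m n : nat) (A : tensor m n) (x : 'cV[R]_n) : 'cV[R]_n :=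
  \col_(i < n) \sum_(t : m.-tuple 'I_n | ohead t == Some i)
    A t * \prod_(j <- behead t) x j 0.

Definition row_abs_sum (m n : nat) (A : tensor m n) (i : 'I_n) : R :=
  \sum_(t : m.-tuple 'I_n | ohead t == Some i) `|A t|.

Definition nonneg_vec (n : nat) (x : 'cV[R]_n) : Prop :=
  forall i : 'I_n, 0 <= x i 0.

Definition pos_part (n : nat) (x : 'cV[R]_n) : 'cV[R]_n :=
  \col_(i < n) Num.max (x i 0) 0.

Definition strictly_semi_positive (m n : nat) (A : tensor m n) : Prop :=
  forall x : 'cV[R]_n, nonneg_vec x -> x != 0 ->
    exists k : 'I_n, 0 < x k 0 /\ 0 < tensor_app A x k 0.

Definition TCP_solution (m n : nat) (A : tensor m n) (q x : 'cV[R]_n) : Prop :=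
  [/\ nonneg_vec x, nonneg_vec (q + tensor_app A x)
    & x^T *m (q + tensor_app A x) = 0].

(* For n > 0 the range is finite and nonempty, so its supremum is its
   maximum, whatever the sign of the values of f. *)
Definition maxI (n : nat) (f : 'I_n -> R) : R := sup (range f).

(* For n > 0 the infimum is a minimum, by continuity over a nonempty compact
   set. The norm [`|x|] on matrices is the sup norm [mx_norm]. *)
Definition beta (m n : nat) (A : tensor m n) : R :=
  inf [set maxI (fun i => x i 0 * tensor_app A x i 0)
      | x in [set x : 'cV[R]_n | nonneg_vec x /\ `|x| = 1]].

End TensorComplementarity.

Arguments tensor R m n : clear implicits.

(* Main.v *)
(** Write [P] for the sup norm of [(-q)_+].  Componentwise [-q <= A x^(m-1)],
    which gives the lower bound.  Complementarity reads
    [x_i (A x^(m-1))_i = x_i (-q_i) <= `|x| P]; since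
    [x |-> x_i (A x^(m-1))_i] is homogeneous of degree [m], rescaling [x] to
    norm 1 gives [beta A * `|x|^m <= `|x| P].  Dividing by [beta A] needs
    [beta A > 0], which comes from compactness. *)
Require Import Defs.
From HB Require Import structures.
From mathcomp Require Import all_boot all_order all_algebra.
From mathcomp Require Import all_classical all_reals all_analysis.
From mathcomp Require Import ring.

Set Implicit Arguments.
Unset Strict Implicit.
Unset Printing Implicit Defensive.

Import Order.TTheory GRing.Theory Num.Theory.
Import numFieldNormedType.Exports.

Local Open Scope classical_set_scope.
Local Open Scope ring_scope.

Lemma le_maxI (R : realType) (n : nat) (f : 'I_n -> R) (i : 'I_n) :
  f i <= maxI f.
Proof.
apply: ub_le_sup; last by exists i.
(* A supremum dominates its set only if the set is bounded above; the sum of all [|f j|] is a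
   bound. *)
exists (\sum_j `|f j|) => _ [j _ <-].
by rewrite (le_trans (ler_norm _))// (bigD1 j)//= lerDl sumr_ge0.
Qed.

Lemma maxI_le (R : realType) (n : nat) (f : 'I_n -> R) (c : R) :
  (0 < n)%N -> (forall i, f i <= c) -> maxI f <= c.
Proof.
move=> n0 fc; apply: sup_le_ub; last by move=> _ [i _ <-].
by exists (f (Ordinal n0)), (Ordinal n0).
Qed.

Lemma le_coord_norm (R : realDomainType) (m n : nat) (x : 'M[R]_(m, n)) i j :
  `|x i j| <= `|x|.
Proof.
rewrite [leRHS]/Num.norm/= mx_normrE.
exact: (le_bigmax 0 (fun ij : 'I_m * 'I_n => `|x ij.1 ij.2|) (i, j)).
Qed.

Lemma norm_mx_le (R : realDomainType) (m n : nat) (x : 'M[R]_(m, n)) (c : R) :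
  0 <= c -> (forall i j, `|x i j| <= c) -> `|x| <= c.
Proof.
by move=> c0 xc; rewrite [leLHS]/Num.norm/= mx_normrE; apply: bigmax_le.
Qed.

Lemma norm_trmx (R : realDomainType) (m n : nat) (x : 'M[R]_(m, n)) :
  `|x^T| = `|x|.
Proof.
apply/le_anti/andP; split; apply: norm_mx_le => // i j.
  by rewrite mxE le_coord_norm.
by have := le_coord_norm x^T j i; rewrite mxE.
Qed.

Lemma norm_const_mx1 (R : realDomainType) (n : nat) :
  (0 < n)%N -> `|const_mx 1 : 'cV[R]_n| = 1.
Proof.
move=> n0; apply/le_anti/andP; split.
  by apply: norm_mx_le => // i j; rewrite mxE normr1.
have := le_coord_norm (const_mx 1 : 'cV[R]_n) (Ordinal n0) 0.
by rewrite mxE normr1.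
Qed.

Section tensor_app.
Context {R : realType} {m n : nat} (A : tensor R m n).

Lemma tensor_appZ (c : R) (x : 'cV[R]_n) :
  tensor_app A (c *: x) = c ^+ (m - 1) *: tensor_app A x.
Proof.
apply/colP => i; rewrite !mxE mulr_sumr; apply: eq_bigr => t _.
under eq_bigr do rewrite mxE.
(* The scalar [c] occurs once per index in [behead t], hence [m.-1] times. *)
rewrite big_split/= big_const_seq count_predT size_behead size_tuple.
by rewrite -Monoid.iteropE -subn1 mulrCA.
Qed.

(** Triangle inequality: each monomial is a product of [m - 1] coordinates, each bounded by the sup
    norm. *)
Lemma tensor_app_le (x : 'cV[R]_n) (i : 'I_n) :
  `|tensor_app A x i 0| <= row_abs_sum A i * `|x| ^+ (m - 1).
Proof.
rewrite mxE mulr_suml; apply: le_trans (ler_norm_sum _ _ _) _.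
apply: ler_sum => t _; rewrite normrM ler_wpM2l// normr_prod.
have -> : (m - 1 = size (behead t))%N by rewrite size_behead size_tuple subn1.
elim: (behead t) => [|j s IHs]; first by rewrite big_nil.
by rewrite big_cons exprS ler_pM// ?prodr_ge0// le_coord_norm.
Qed.

Lemma tensor_app_tr_continuous (i : 'I_n) :
  continuous (fun v : 'rV[R]_n => tensor_app A v^T i 0).
Proof.
have -> : (fun v : 'rV[R]_n => tensor_app A v^T i 0) = fun v : 'rV[R]_n =>
    \sum_(t : m.-tuple 'I_n | ohead t == Some i)
      A t * \prod_(j <- behead t) v 0 j.
  apply/funext => v; rewrite mxE; apply: eq_bigr => t _; congr (_ * _).
  by apply: eq_bigr => j _; rewrite mxE.
apply: continuous_big => [|t _ v]; first exact: add_continuous.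
apply: continuousM; first exact: cst_continuous.
apply: (@continuous_big R^o) => [|j _]; first exact: mul_continuous.
exact: coord_continuous.
Qed.

Lemma row_abs_sum_ge0 (i : 'I_n) : 0 <= row_abs_sum A i.
Proof. exact: sumr_ge0. Qed.

End tensor_app.

(* The infimum defining [beta] is bounded below by the minimum of a continuous
   positive function over a compact set, namely the maximum of [0] and the
   [x_i (A x^(m-1))_i]. Row vectors are used because compactness results are
   available for them only. *)
Lemma beta_lower_bound (R : realType) (m n : nat) (A : tensor R m n) :
  (0 < n)%N -> strictly_semi_positive A ->
  exists2 c : R, 0 < c & forall x : 'cV[R]_n, nonneg_vec x -> `|x| = 1 ->
    c <= maxI (fun i => x i 0 * tensor_app A x i 0).
Proof.
move=> n0 hA.
pose f (i : 'I_n) (v : 'rV[R]_n) := v 0 i * tensor_app A v^T i 0.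
pose g (v : 'rV[R]_n) := \big[Num.max/0]_i f i v.
pose K := [set v : 'rV[R]_n | forall i, `[0, 1]%classic (v ord0 i)]
          `&` [set v : 'rV[R]_n | `|v| = 1].
have inK (x : 'cV[R]_n) : nonneg_vec x -> `|x| = 1 -> K x^T.
  move=> x0 x1; split=> /= [i|]; last by rewrite norm_trmx.
  rewrite mxE in_itv/= x0 -x1/=.
  exact: le_trans (ler_norm _) (le_coord_norm _ _ _).
have K0 : K !=set0.
  exists (const_mx 1 : 'cV[R]_n)^T.
  by apply: inK (norm_const_mx1 _ n0) => i; rewrite mxE.
(* [K] is the closed unit sphere cut with the cube [[0, 1]^n], a product of compact segments. *)
have cK : compact K.
  apply: compact_closedI.
    by apply: (@rV_compact R _ (fun=> `[0, 1]%classic)) => _; exact: segment_compact.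
  apply: (@preimage_closed _ _ (fun v : 'rV[R]_n => `|v|) [set 1 : R]).
    by move=> v _; exact: norm_continuous.
  exact: closed_eq.
have cg : continuous g.
  apply: continuous_big => [|i _ v]; first exact: max_continuous.
  by apply: continuousM; [exact: coord_continuous|exact: tensor_app_tr_continuous].
have [c /set_mem[c01 c1] cmin] :=
  compact_EVT_min K0 cK (continuous_subspaceT cg).
exists (g c) => [|x x0 x1].
  have [||k [ck Ack]] := hA c^T.
  - by move=> i; rewrite mxE; have := c01 i; rewrite /= in_itv/= => /andP[].
  - by rewrite -normr_eq0 norm_trmx c1 oner_eq0.
  apply: lt_le_trans (le_bigmax 0 (f^~ c) k).
  by rewrite mxE in ck; exact: mulr_gt0.
apply: le_trans (cmin _ (mem_set (inK _ x0 x1))) _.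
(* [g] also takes the maximum with [0]; strict semi-positivity gives an index with positive product,
   so this [0] stays below [maxI]. *)
have [|k [xk Axk]] := hA x x0; first by rewrite -normr_eq0 x1 oner_eq0.
apply: bigmax_le => [|i _].
  apply: le_trans (le_maxI _ k).
  by rewrite ltW// mulr_gt0.
rewrite /f mxE trmxK.
exact: (le_maxI (fun i => x i 0 * tensor_app A x i 0)).
Qed.

Lemma beta_gt0 (R : realType) (m n : nat) (A : tensor R m n) :
  (0 < n)%N -> strictly_semi_positive A -> 0 < beta A.
Proof.
move=> n0 hA; have [c c0 cle] := beta_lower_bound n0 hA.
apply: lt_le_trans c0 _; apply: lb_le_inf => [|_ [x [x0 x1] <-]]; last exact: cle.
(* The set must be nonempty for its infimum to exceed a lower bound; the all-ones vector is a
   witness. *)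
pose u : 'cV[R]_n := const_mx 1.
exists (maxI (fun i => u i 0 * tensor_app A u i 0)), u => //=.
by split=> [i|]; [rewrite mxE|exact: norm_const_mx1].
Qed.

Lemma beta_le (R : realType) (m n : nat) (A : tensor R m n) (x : 'cV[R]_n) :
  (0 < n)%N -> strictly_semi_positive A -> nonneg_vec x -> `|x| = 1 ->
  beta A <= maxI (fun i => x i 0 * tensor_app A x i 0).
Proof.
move=> n0 hA x0 x1; have [c _ cle] := beta_lower_bound n0 hA.
apply: ge_inf; last by exists x.
by exists c => _ [y [y0 y1] <-]; exact: cle.
Qed.

(** The zero inner product is a sum of nonnegative terms, so every term vanishes. *)
Lemma TCP_complementarity (R : realType) (m n : nat) (A : tensor R m n)
    (q x : 'cV[R]_n) (i : 'I_n) :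
  TCP_solution A q x -> x i 0 * tensor_app A x i 0 = x i 0 * - q i 0.
Proof.
move=> [x0 w0 /matrixP/(_ 0 0)] xw0.
have : x^T 0 i * (q + tensor_app A x) i 0 == 0.
  rewrite mxE [RHS]mxE in xw0; move/eqP: xw0.
  rewrite psumr_eq0 => [/allP/(_ i (mem_index_enum i))//|j _].
  by rewrite mxE mulr_ge0.
rewrite mxE [X in _ * X]mxE mulrDr addr_eq0 => /eqP xq.
by rewrite mulrN xq opprK.
Qed.

Lemma pos_part_ge0 (R : realType) (n : nat) (x : 'cV[R]_n) i :
  0 <= pos_part x i 0.
Proof. by rewrite mxE le_max lexx orbT. Qed.

Lemma le_norm_pos_part (R : realType) (n : nat) (x : 'cV[R]_n) i :
  x i 0 <= `|pos_part x|.
Proof.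
apply: le_trans (le_coord_norm _ i 0); apply: le_trans (ler_norm _).
by rewrite mxE le_max lexx.
Qed.

Theorem theorem3p13 (R : realType) (m n : nat) (hm : (2 <= m)%N) (hn : (1 <= n)%N)
    (A : tensor R m n) (hA : strictly_semi_positive A)
    (q x : 'cV[R]_n) (hx : TCP_solution A q x) (hm_even : ~~ odd m) :
  `|pos_part (- q)| / maxI (row_abs_sum A) <= `|x| ^+ (m - 1)
  /\ `|x| ^+ (m - 1) <= `|pos_part (- q)| / beta A.
Proof.
have [x0 w0 _] := hx; split.
  have M0 : 0 <= maxI (row_abs_sum A).
    exact: le_trans (row_abs_sum_ge0 A (Ordinal hn)) (le_maxI _ _).
  (* Division by [0] gives [0], so the bound is immediate in that case. *)
  have [->|Mn0] := eqVneq (maxI (row_abs_sum A)) 0.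
    by rewrite invr0 mulr0 exprn_ge0.
  rewrite ler_pdivrMr ?lt_def ?Mn0// mulrC.
  apply: norm_mx_le => [|i j]; first by rewrite mulr_ge0// exprn_ge0.
  rewrite ord1 ger0_norm ?pos_part_ge0// mxE ge_max mxE.
  apply/andP; split; last by rewrite mulr_ge0// exprn_ge0.
  apply: (@le_trans _ _ (tensor_app A x i 0)).
    by have := w0 i; rewrite mxE addrC -lerBlDr sub0r.
  apply: le_trans (ler_norm _) (le_trans (tensor_app_le A x i) _).
  by rewrite ler_wpM2r ?exprn_ge0// le_maxI.
have b0 := beta_gt0 hn hA.
(* At [x = 0] the power vanishes because [2 <= m] makes its exponent positive. *)
have [->|xn0] := eqVneq x 0.
  by rewrite normr0 expr0n subn_eq0 leqNgt hm divr_ge0// ltW.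
have nx0 : 0 < `|x| by rewrite normr_gt0.
pose y := `|x|^-1 *: x.
have y0 : nonneg_vec y by move=> i; rewrite mxE mulr_ge0// invr_ge0.
have y1 : `|y| = 1 by rewrite mx_normZ normfV normr_id mulVf// gt_eqF.
have bP : beta A <= `|x| ^- (m - 1) * `|pos_part (- q)|.
  apply: le_trans (beta_le hn hA y0 y1) _; apply: maxI_le => // i.
  rewrite tensor_appZ mxE [in X in _ * X]mxE mulrACA (TCP_complementarity i hx).
  (* Of the [m] factors [|x|^-1], one stays with [x i 0] to form [y i 0], which lies in [[0, 1]];
     thus [y i 0 * - q i 0] is at most the norm of the positive part. *)
  have -> : `|x|^-1 * `|x|^-1 ^+ (m - 1) * (x i 0 * - q i 0) =
            `|x| ^- (m - 1) * (`|x|^-1 * x i 0 * - q i 0).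
    by rewrite exprVn; ring.
  rewrite ler_pM2l ?invr_gt0 ?exprn_gt0//.
  apply: (@le_trans _ _ (`|x|^-1 * x i 0 * `|pos_part (- q)|)).
    rewrite ler_wpM2l ?mulr_ge0 ?invr_ge0//.
    by have := le_norm_pos_part (- q) i; rewrite [leLHS]mxE.
  rewrite ler_piMl// mulrC ler_pdivrMr// mul1r.
  exact: le_trans (ler_norm _) (le_coord_norm x i 0).
rewrite ler_pdivlMr//; apply: le_trans (ler_wpM2l _ bP) _.
  exact: exprn_ge0.
by rewrite mulVKf// gt_eqF// exprn_gt0.
Qed.
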